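(* Let $A$ and $B$ be unital C*-algebras and let $T\colon A\to B$ be a unital surjective linear operator which preserves the numerical radius, i.e. $\nu(Tx)=\nu(x)$ for all $x\in A$. Then $T$ is a Jordan *-isomorphism.
   Context: For an element $x$ of a unital C*-algebra $A$, the numerical radius is $\nu(x)=\sup\{|\varphi(x)| : \varphi \text{ a state of } A\}$. A Jordan *-isomorphism is a bijective linear map $S$ with $S(x^* )=S(x)^*$ and $S(x\circ y)=Sx\circ Sy$ for all $x,y$, where $x\circ y=\tfrac12(xy+yx)$. *)

(* Defs.v *)
From HB Require Import structures.
From mathcomp Require Import all_boot all_order all_algebra.
From mathcomp Require Import classical_sets reals.
From mathcomp.real_closed Require Import complex.
Set Implicit Arguments. Unset Strict Implicit. Unset Printing Implicit Defensive.
Import Order.TTheory GRing.Theory Num.Theory.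
Local Open Scope ring_scope.

Definition cabs (R : realType) (z : R[i]) : R := complex.Re `|z|.

Record is_cstar_alg (R : realType) (A : algType R[i])
    (star : A -> A) (nrm : A -> R) : Prop := CstarAlg {
  star_add : forall x y, star (x + y) = star x + star y;
  star_scale : forall (c : R[i]) x, star (c *: x) = c^* *: star x;
  star_mul : forall x y, star (x * y) = star y * star x;
  star_invol : forall x, star (star x) = x;
  nrm_eq0 : forall x, nrm x = 0 -> x = 0;
  nrm_triangle : forall x y, nrm (x + y) <= nrm x + nrm y;
  nrm_scale : forall (c : R[i]) x, nrm (c *: x) = cabs c * nrm x;
  nrm_submul : forall x y, nrm (x * y) <= nrm x * nrm y;
  nrm_cstar : forall x, nrm (star x * x) = nrm x ^+ 2;
  nrm_complete : forall u : nat -> A,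
    (forall e : R, 0 < e -> exists N, forall m n, (N <= m)%N -> (N <= n)%N ->
        nrm (u m - u n) < e) ->
    exists l : A, forall e : R, 0 < e -> exists N, forall n, (N <= n)%N ->
        nrm (u n - l) < e
}.

Definition is_state (R : realType) (A : algType R[i]) (star : A -> A)
    (phi : A -> R[i]) : Prop :=
  [/\ forall (a : R[i]) x y, phi (a *: x + y) = a * phi x + phi y,
      forall x, 0 <= phi (star x * x)
    & phi 1 = 1].

Definition numrad (R : realType) (A : algType R[i]) (star : A -> A) (x : A) : R :=
  sup [set r : R | exists phi : A -> R[i], is_state star phi /\ r = cabs (phi x)].

Definition jprod (R : realType) (A : algType R[i]) (x y : A) : A :=
  (2 : R[i])^-1 *: (x * y + y * x).

Definition jordan_star_iso (R : realType) (A B : algType R[i])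
    (starA : A -> A) (starB : B -> B) (S : A -> B) : Prop :=
  [/\ bijective S,
      forall (a : R[i]) x y, S (a *: x + y) = a *: S x + S y,
      forall x, S (starA x) = starB (S x)
    & forall x y, S (jprod x y) = jprod (S x) (S y)].

(* Main.v *)
Require Import Defs.
From HB Require Import structures.
From mathcomp Require Import all_boot all_order all_algebra.
From mathcomp Require Import boolp classical_sets reals.
From mathcomp.real_closed Require Import complex.
From mathcomp Require Import ring lra.
From Stdlib Require Ncring Ncring_tac.
Import Order.TTheory GRing.Theory Num.Theory.
Local Open Scope ring_scope.

Set Implicit Arguments.
Unset Strict Implicit.

(** If [phi] is a state of [B], then [phi \o T] is a unital functional dominated by the
    numerical radius of [A], which forces it to be a state.  States separate the points
    of a C*-algebra, so [T] is injective and *-preserving, and its inverse satisfies the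
    same hypotheses.  Kadison's inequality [T h ^+ 2 <= T (h ^+ 2)] for hermitian [h],
    tested on states and applied to [T] and to its inverse, gives [T (h ^+ 2) = T h ^+ 2],
    and polarization concludes.

    Kadison's inequality is the positivity of
    [\sum_k (k - n T h) T (p_k) (k - n T h) = n^2 (T (h^2) - (T h)^2) + n T (h - h^2)]
    for the Bernstein partition of unity [p_k = 'C(n, k) h^k (1 - h)^(n - k)], divided by
    [n^2] as [n] grows.

    That states separate points follows from Hahn-Banach, once [x^* x] is known to be
    spectrally positive.  The only analytic input is the square root of [1 - h] for a
    hermitian [h] of norm less than one. *)

(** * Identities in noncommutative rings by normalization *)

#[local] Instance nc_ring_ops (A : pzRingType) :
  @Ncring.Ring_ops A 0 1 +%R *%R (fun x y : A => x - y) -%R eq := {}.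

#[local] Instance nc_ring_pzRing (A : pzRingType) : Ncring.Ring (Ro := nc_ring_ops A).
Proof.
split; rewrite /Algebra_syntax.equality /Ncring.eq_notation.
- exact: RelationClasses.eq_equivalence.
- by move=> x y -> u v ->.
- by move=> x y -> u v ->.
- by move=> x y -> u v ->.
- by move=> x y ->.
- exact: add0r.
- exact: addrC.
- exact: addrA.
- exact: mul1r.
- exact: mulr1.
- exact: mulrA.
- exact: mulrDl.
- by move=> x y z; exact: mulrDr.
- by [].
- exact: addrN.
Qed.

Local Ltac nc_ring := rewrite ?expr2 ?mulr2n; Ncring_tac.non_commutative_ring.

Local Notation "x %:C" := (real_complex _ x) : ring_scope.

(** * Elementary estimates on real powers *)

Lemma bernoulli_ineq (R : realType) (d : R) n :
  0 <= d -> 1 + n%:R * d <= (1 + d) ^+ n.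
Proof.
move=> d0; elim: n => [|n IH]; first by rewrite expr0 mul0r addr0.
rewrite exprS -natr1; apply: le_trans (ler_wpM2l _ IH); last by lra.
have : 0 <= n%:R * d * d by rewrite !mulr_ge0.
by nra.
Qed.

Lemma exists_nat_gt (R : realType) (x : R) : exists n : nat, x < n%:R.
Proof.
exists (Num.Def.archi_bound `|x|); apply: le_lt_trans (ler_norm x) _.
exact: (archi_boundP (normr_ge0 x)).
Qed.

Lemma expr_small (R : realType) (r e : R) : 0 <= r -> r < 1 -> 0 < e ->
  exists N, forall n, (N <= n)%N -> r ^+ n < e.
Proof.
move=> r0 r1 e0.
have [->|rn0] := eqVneq r 0.
  by exists 1%N => -[|n] // _; rewrite expr0n.
have rp : 0 < r by rewrite lt_neqAle eq_sym rn0.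
have [N hN] := exists_nat_gt (e^-1 / (r^-1 - 1)).
have d0 : 0 < r^-1 - 1 by rewrite subr_gt0 invf_gt1.
exists N => n Nn.
have := @bernoulli_ineq R (r^-1 - 1) n (ltW d0).
have -> : 1 + (r^-1 - 1) = r^-1 by lra.
move=> hb; rewrite -[ltLHS]invrK -[ltRHS]invrK ltf_pV2 ?posrE ?invr_gt0 ?exprn_gt0 //.
rewrite -exprVn; apply: lt_le_trans hb.
move: hN; rewrite ltr_pdivrMr // => hN.
have : N%:R * (r^-1 - 1) <= n%:R * (r^-1 - 1) by rewrite ler_pM2r // ler_nat.
by lra.
Qed.

(** * Involution, norm and square roots in a C*-algebra *)

Section CstarBasics.
Variables (R : realType) (A : algType R[i]) (star : A -> A) (nrm : A -> R).
Hypothesis hA : is_cstar_alg star nrm.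
Local Notation I := ('i%C : R[i]).
Implicit Types (x y z h : A) (r s t e : R).

Lemma cabs_real t : cabs t%:C = `|t|.
Proof. by rewrite /cabs normc_def /= expr0n /= addr0 sqrtr_sqr. Qed.

Lemma cabs_sqr (c : R[i]) : cabs c ^+ 2 = complex.Re c ^+ 2 + complex.Im c ^+ 2.
Proof. by rewrite /cabs normc_def /= sqr_sqrtr // addr_ge0 // sqr_ge0. Qed.

Lemma cabs_ge0 (c : R[i]) : 0 <= cabs c.
Proof. by rewrite /cabs normc_def /= sqrtr_ge0. Qed.

Lemma starD x y : star (x + y) = star x + star y.
Proof. exact: (star_add hA). Qed.

Lemma starZ (c : R[i]) x : star (c *: x) = c^* *: star x.
Proof. exact: (star_scale hA). Qed.

Lemma starM x y : star (x * y) = star y * star x.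
Proof. exact: (star_mul hA). Qed.

Lemma starK x : star (star x) = x.
Proof. exact: (star_invol hA). Qed.

Lemma starN x : star (- x) = - star x.
Proof. by rewrite -[- x]scaleN1r starZ rmorphN rmorph1 scaleN1r. Qed.

Lemma star_sub x y : star (x - y) = star x - star y.
Proof. by rewrite starD starN. Qed.

Lemma starZr t x : star (t%:C *: x) = t%:C *: star x.
Proof. by rewrite starZ [t%:C^*]conjc_real. Qed.

Lemma starZi x : star (I *: x) = - (I *: star x).
Proof.
rewrite starZ -scaleNr; congr (_ *: _).
by apply/eqP; rewrite eq_complex /= oppr0 !eqxx.
Qed.

Lemma scaleII x : I *: (I *: x) = - x.
Proof. by rewrite scalerA -expr2 sqr_i scaleN1r. Qed.

Lemma star1 : star 1 = 1.
Proof.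
rewrite -[LHS]mulr1; apply: (can_inj starK).
by rewrite starM starK mulr1.
Qed.

Lemma star0 : star 0 = 0.
Proof. by rewrite -{1}(subrr (0 : A)) star_sub subrr. Qed.

Lemma starX x n : star (x ^+ n) = star x ^+ n.
Proof. by elim: n => [|n IH]; rewrite ?expr0 ?star1 // exprS starM IH -exprSr. Qed.

Lemma nrmZr t x : nrm (t%:C *: x) = `|t| * nrm x.
Proof. by rewrite (nrm_scale hA) cabs_real. Qed.

Lemma nrmZi x : nrm (I *: x) = nrm x.
Proof.
by rewrite (nrm_scale hA) /cabs normc_def /= expr0n /= add0r expr1n sqrtr1 mul1r.
Qed.

Lemma nrm0 : nrm 0 = 0.
Proof. by rewrite -(scaler0 _ (0 : R)%:C) nrmZr normr0 mul0r. Qed.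

Lemma nrmN x : nrm (- x) = nrm x.
Proof.
have -> : - x = (-1 : R)%:C *: x by rewrite rmorphN rmorph1 scaleN1r.
by rewrite nrmZr normrN normr1 mul1r.
Qed.

Lemma nrmBC x y : nrm (x - y) = nrm (y - x).
Proof. by rewrite -nrmN opprB. Qed.

Lemma nrmD x y : nrm (x + y) <= nrm x + nrm y.
Proof. exact: (nrm_triangle hA). Qed.

Lemma nrmB x y : nrm (x - y) <= nrm x + nrm y.
Proof. by rewrite -(nrmN y) nrmD. Qed.

Lemma nrm_ge0 x : 0 <= nrm x.
Proof. by have := nrmB x x; rewrite subrr nrm0; lra. Qed.

Lemma nrmM x y : nrm (x * y) <= nrm x * nrm y.
Proof. exact: (nrm_submul hA). Qed.

Lemma nrm1 : nrm 1 = 1.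
Proof.
have := nrm_cstar hA 1; rewrite star1 mulr1 => h.
have n0 : nrm 1 != 0 by apply/eqP => /(nrm_eq0 hA) /eqP; rewrite oner_eq0.
by apply: (mulfI n0); rewrite mulr1 -expr2 -h.
Qed.

Lemma nrm_star x : nrm (star x) = nrm x.
Proof.
suff le y : nrm y <= nrm (star y) by apply/eqP; rewrite eq_le le -{2}(starK x) le.
have := nrmM (star y) y; rewrite (nrm_cstar hA) expr2.
have [->|n0] := eqVneq (nrm y) 0; first by rewrite nrm_ge0.
by rewrite ler_pM2r // lt_neqAle eq_sym n0 nrm_ge0.
Qed.

Lemma nrm_sq x : star x = x -> nrm (x * x) = nrm x ^+ 2.
Proof. by move=> hx; rewrite -(nrm_cstar hA) hx. Qed.

Lemma nrmX_le x n : nrm (x ^+ n) <= nrm x ^+ n.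
Proof.
elim: n => [|n IH]; first by rewrite !expr0 nrm1.
by rewrite !exprS; apply: le_trans (nrmM _ _) _; rewrite ler_wpM2l ?nrm_ge0.
Qed.

(** The C*-identity settles powers of two by repeated squaring. For other [n], factor [x ^+ (2 ^ n)]
    as [x ^+ n * x ^+ (2 ^ n - n)] and cancel the norm of the second factor. *)
Lemma nrmX x n : star x = x -> nrm (x ^+ n) = nrm x ^+ n.
Proof.
move=> hx; have [x0|xn0] := eqVneq (nrm x) 0.
  rewrite x0 (nrm_eq0 hA x0) !expr0n; case: eqP => _; [exact: nrm1|exact: nrm0].
have xp : 0 < nrm x by rewrite lt_neqAle eq_sym xn0 nrm_ge0.
have pow2 k : nrm (x ^+ (2 ^ k)) = nrm x ^+ (2 ^ k).
  elim: k => [|k IH]; first by rewrite expn0 !expr1.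
  by rewrite expnSr !exprM expr2 nrm_sq ?starX ?hx // IH.
apply/eqP; rewrite eq_le nrmX_le /=.
have nk : (n <= 2 ^ n)%N by apply: ltnW; apply: ltn_expl.
have := nrmM (x ^+ n) (x ^+ (2 ^ n - n)); rewrite -exprD subnKC // pow2.
move=> h1; have h2 := le_trans h1 (ler_wpM2l (nrm_ge0 _) (nrmX_le x (2 ^ n - n))).
by move: h2; rewrite -[in leLHS](subnKC nk) exprD ler_pM2r ?exprn_gt0.
Qed.

(** The form in which limits are used: an equality follows once the norm of the difference is at
    most a fixed multiple of every [e]. *)
Lemma nrm_small_eq0 x (C : R) : (forall e, 0 < e -> nrm x <= C * e) -> x = 0.
Proof.
move=> h; apply: (nrm_eq0 hA); apply/eqP; rewrite eq_le nrm_ge0 andbT leNgt.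
apply/negP => xp; set d := nrm x / (2 * (`|C| + 1)).
have C0 : 0 <= `|C| by [].
have d0 : 0 < d by rewrite divr_gt0 //; lra.
have := h _ d0; have : C * d <= `|C| * d by rewrite ler_pM2r // ler_norm.
have : nrm x = 2 * (`|C| * d) + 2 * d.
  by rewrite /d; field; apply/eqP; lra.
have : 0 <= `|C| * d by rewrite mulr_ge0 // ltW.
by lra.
Qed.

Lemma nrm_sqrB x y : nrm (x * x - y * y) <= (nrm x + nrm y) * nrm (x - y).
Proof.
have -> : x * x - y * y = x * (x - y) + (x - y) * y by nc_ring.
have := nrmD (x * (x - y)) ((x - y) * y); have := nrmM x (x - y).
by have := nrmM (x - y) y; lra.
Qed.

(* [w = 1 - y] where [y] is the fixed point of the contraction [y |-> (h + y^2) / 2]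
   of the ball of radius [nrm h]. *)
Lemma herm_sqrt h : star h = h -> nrm h < 1 ->
  exists w, [/\ star w = w, w * w = 1 - h &
    forall g, g * h = h * g -> g * w = w * g].
Proof.
move=> hh r1; set r := nrm h in r1; have r0 : 0 <= r := nrm_ge0 h.
pose F y := (2^-1 : R)%:C *: (h + y * y).
pose u n := iter n F 0.
have uS n : u n.+1 = F (u n) by [].
have half : `|2^-1 : R| = 2^-1 by rewrite ger0_norm // invr_ge0 ler0n.
have ub n : nrm (u n) <= r.
  elim: n => [|n IH]; first by rewrite /u /= nrm0.
  rewrite uS nrmZr half; have := nrmD h (u n * u n).
  have : nrm (u n) * nrm (u n) <= r * 1.
    by apply: ler_pM; rewrite ?nrm_ge0 //; apply: le_trans IH (ltW r1).
  by have := nrmM (u n) (u n); rewrite -/r; lra.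
have uh n : star (u n) = u n.
  elim: n => [|n IH]; first by rewrite /u /= star0.
  by rewrite uS starZr starD hh starM IH.
have uc n g : g * h = h * g -> g * u n = u n * g.
  move=> gh; elim: n => [|n IH]; first by rewrite /u /= mulr0 mul0r.
  by rewrite uS -scalerAl -scalerAr mulrDl mulrDr gh mulrA IH -mulrA IH mulrA.
(* All iterates lie in the ball of radius [r], where squaring is [2 r]-Lipschitz, and [F] halves:
   the contraction factor is [r]. *)
have contr n k : nrm (u (n + k)%N - u n) <= r ^+ n.
  elim: n => [|n IH].
    rewrite expr0 /u /= subr0; exact: le_trans (ub k) (ltW r1).
  rewrite addSn !uS -scalerBr nrmZr half opprD addrACA subrr add0r.
  have := nrm_sqrB (u (n + k)%N) (u n); have := ub (n + k)%N; have := ub n.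
  have := nrm_ge0 (u (n + k)%N - u n); rewrite exprS.
  set a := nrm (u _ - _) in IH *; set b := nrm _; set c := nrm (u (n+k)%N).
  move=> a0 bl cl hd.
  have : (c + b) * a <= (2 * r) * a by rewrite ler_wpM2r //; lra.
  have : r * a <= r * r ^+ n by rewrite ler_wpM2l.
  by lra.
have [y hy] : exists l, forall e, 0 < e -> exists N, forall n, (N <= n)%N -> nrm (u n - l) < e.
  apply: (nrm_complete hA) => e e0.
  have e2 : 0 < e / 2 by lra.
  have [N hN] := expr_small r0 r1 e2.
  exists N => m n Nm Nn.
  have -> : u m - u n = (u m - u N) - (u n - u N) by nc_ring.
  apply: le_lt_trans (nrmB _ _) _.
  have := contr N (m - N)%N; have := contr N (n - N)%N; rewrite !subnKC //.
  by have := hN N (leqnn N); lra.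
have ylim e : 0 < e -> exists n, nrm (u n - y) < e /\ nrm (u n.+1 - y) < e.
  by move=> /hy [N hN]; exists N; split; apply: hN.
have yF : y = F y.
  apply/eqP; rewrite -subr_eq0; apply/eqP.
  apply: (@nrm_small_eq0 _ (1 + (r + nrm y))) => e e0.
  have [n [h1 h2]] := ylim _ e0.
  have -> : y - F y = (y - u n.+1) + (2^-1 : R)%:C *: (u n * u n - y * y).
    by rewrite uS /F !scalerDr scalerN; nc_ring.
  apply: le_trans (nrmD _ _) _; rewrite nrmZr half nrmBC.
  have := nrm_sqrB (u n) y; have := ub n; have := nrm_ge0 y.
  have := nrm_ge0 (u n - y); have := nrm_ge0 (u n).
  set a := nrm (u n); set b := nrm y; set c := nrm (u n - y) in h1 *; set d := nrm (_ - _).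
  move=> a0 c0 b0 ar hd.
  have : (a + b) * c <= (r + b) * e by apply: ler_pM; lra.
  have : 0 <= (r + b) * e by rewrite mulr_ge0 //; lra.
  by move: h2; rewrite mulrDl; lra.
have yh : star y = y.
  apply/eqP; rewrite -subr_eq0; apply/eqP.
  apply: (@nrm_small_eq0 _ 2) => e e0.
  have [n [h1 _]] := ylim _ e0.
  have -> : star y - y = (u n - y) - star (u n - y) by rewrite star_sub uh; nc_ring.
  by apply: le_trans (nrmB _ _) _; rewrite nrm_star; lra.
exists (1 - y); split.
- by rewrite star_sub star1 yh.
(* The fixed point equation [2 y = h + y^2] is [(1 - y)^2 = 1 - h]. *)
- have : y + y = h + y * y.
    rewrite {1 2}yF -scalerDl -rmorphD (_ : 2^-1 + 2^-1 = 1 :> R); last by lra.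
    by rewrite rmorph1 scale1r.
  move=> e; have -> : h = y + y - y * y by rewrite e; nc_ring.
  nc_ring.
- move=> g gh; rewrite mulrBr mulrBl mulr1 mul1r; congr (_ - _).
  apply/eqP; rewrite -subr_eq0; apply/eqP.
  apply: (@nrm_small_eq0 _ (2 * nrm g)) => e e0.
  have [n [h1 _]] := ylim _ e0.
  have -> : g * y - y * g = (u n - y) * g - g * (u n - y).
    by rewrite mulrBr mulrBl (uc n g gh); nc_ring.
  apply: le_trans (nrmB _ _) _.
  have := nrmM (u n - y) g; have := nrmM g (u n - y).
  have : nrm g * nrm (u n - y) <= nrm g * e by rewrite ler_wpM2l ?nrm_ge0 // ltW.
  by rewrite [nrm (u n - y) * _]mulrC; lra.
Qed.

End CstarBasics.

(** * Spectral positivity *)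

(** If [d = rho - 1] were positive, the square of Bernoulli's inequality would give
    [rho ^+ (2 m) >= (1 + m d)^2], which is quadratic in [m] and overtakes the linear bound. *)
Lemma growth_le1 (R : realType) (rho C : R) :
  (forall n, rho ^+ n <= 1 + n%:R * C) -> rho <= 1.
Proof.
move=> h; rewrite leNgt; apply/negP => r1; set d := rho - 1.
have d0 : 0 < d by rewrite subr_gt0.
have d2 : 0 < d ^+ 2 by rewrite exprn_gt0.
have [m hm] := exists_nat_gt (2 * `|C| / d ^+ 2).
have C0 : C <= `|C| by exact: ler_norm.
have Cp : 0 <= `|C| by [].
have mp : 0 < m%:R :> R by apply: le_lt_trans hm; rewrite divr_ge0 ?mulr_ge0 // ltW.
have := bernoulli_ineq m (ltW d0); rewrite (_ : 1 + d = rho); last by rewrite /d; lra.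
move=> hb; have hn := h (m * 2)%N; rewrite exprM natrM in hn.
have md : 0 <= m%:R * d by rewrite mulr_ge0 // ltW.
have h3 : (1 + m%:R * d) ^+ 2 <= (rho ^+ m) ^+ 2.
  by rewrite ler_sqr ?nnegrE //; lra.
move: hm; rewrite ltr_pdivrMr // => hm.
have h4 : m%:R * (2 * `|C|) < m%:R * (m%:R * d ^+ 2) by rewrite ltr_pM2l.
have h5 : m%:R * C <= m%:R * `|C| by rewrite ler_pM2l.
have e1 : (1 + m%:R * d) ^+ 2 = 1 + 2 * (m%:R * d) + m%:R * (m%:R * d ^+ 2) by ring.
by lra.
Qed.

Section SpectralPositivity.
Variables (R : realType) (A : algType R[i]) (star : A -> A) (nrm : A -> R).
Hypothesis hA : is_cstar_alg star nrm.
Local Notation I := ('i%C : R[i]).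
Implicit Types (a b x y z h : A) (r s t e : R).

Lemma constD s t : (s + t)%:C%:A = s%:C%:A + t%:C%:A :> A.
Proof. by rewrite rmorphD scalerDl. Qed.

Lemma constN t : (- t)%:C%:A = - t%:C%:A :> A.
Proof. by rewrite rmorphN scaleNr. Qed.

Lemma const1 : (1 : R)%:C%:A = 1 :> A.
Proof. by rewrite rmorph1 scale1r. Qed.

Lemma nrm_const t : nrm t%:C%:A = `|t|.
Proof. by rewrite (nrmZr hA) (nrm1 hA) mulr1. Qed.

Lemma star_const t : star t%:C%:A = t%:C%:A.
Proof. by rewrite (starZr hA) (star1 hA). Qed.

(* For [e = 0] this says that the spectrum of the hermitian element [a] lies in
   [[0, 2 t]]; the slack [e] makes the condition closed. *)
Definition spos a := star a = a /\
  forall e, 0 < e -> exists2 t, 0 <= t & nrm (t%:C%:A - a) <= t + e.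

Lemma spos_herm a : spos a -> star a = a.
Proof. by case. Qed.

(** Increasing [t] by [|s|] raises both sides of the norm bound by at most, respectively exactly,
    [|s|]. *)
Lemma spos_large a s e : spos a -> 0 < e ->
  exists t, [/\ s <= t, 0 <= t & nrm (t%:C%:A - a) <= t + e].
Proof.
move=> [_ ha] /ha [t t0 ht]; exists (t + `|s|); split.
- by have := ler_norm s; lra.
- by rewrite addr_ge0.
- rewrite constD addrAC; apply: le_trans (nrmD hA _ _) _.
  by rewrite nrm_const normr_id; lra.
Qed.

Lemma sposD a b : spos a -> spos b -> spos (a + b).
Proof.
move=> [ha pa] [hb pb]; split=> [|e e0]; first by rewrite (starD hA) ha hb.
have e2 : 0 < e / 2 by lra.
have [t t0 ht] := pa _ e2; have [s s0 hs] := pb _ e2.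
exists (t + s); first by rewrite addr_ge0.
rewrite constD opprD addrACA; apply: le_trans (nrmD hA _ _) _; lra.
Qed.

Lemma sposZ (c : R) a : 0 <= c -> spos a -> spos (c%:C *: a).
Proof.
move=> c0 [ha pa]; split=> [|e e0]; first by rewrite (starZr hA) ha.
have e2 : 0 < e / (c + 1) by rewrite divr_gt0 //; lra.
have [t t0 ht] := pa _ e2; exists (c * t); first by rewrite mulr_ge0.
rewrite rmorphM -scalerA -scalerBr (nrmZr hA) ger0_norm //.
apply: le_trans (ler_wpM2l c0 ht) _; rewrite mulrDr lerD2l mulrCA.
by rewrite ger_pMr // ler_pdivrMr; lra.
Qed.

Lemma spos_const (c : R) : 0 <= c -> spos c%:C%:A.
Proof.
move=> c0; split=> [|e e0]; first exact: star_const.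
by exists c => //; rewrite subrr (nrm0 hA); lra.
Qed.

Lemma spos_const_ge0 (c : R) : spos c%:C%:A -> 0 <= c.
Proof.
move=> [_ pc]; rewrite leNgt; apply/negP => c0.
have e0 : 0 < - c / 2 by lra.
have [t t0] := pc _ e0; rewrite -scalerBl -rmorphB nrm_const => ht.
by have := ler_norm (t - c); lra.
Qed.

Lemma spos0 : spos 0.
Proof. by have := spos_const (lexx 0); rewrite rmorph0 scale0r. Qed.

Lemma sposMn a n : spos a -> spos (a *+ n).
Proof.
by move=> pa; elim: n => [|n IH]; rewrite ?mulr0n ?mulrS; [exact: spos0|exact: sposD].
Qed.

Lemma spos_nrm_sub h : star h = h -> spos ((nrm h)%:C%:A - h).
Proof.
move=> hh; split=> [|e e0]; first by rewrite (star_sub hA) star_const hh.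
exists (nrm h); first exact: (nrm_ge0 hA).
by rewrite opprB addrCA subrr addr0; lra.
Qed.

(** With [h = (t - a) / (t + e)] one has [a + e = (t + e) (1 - h)]. Taking slack [e / 2] for [t]
    makes [nrm h] strictly less than one. *)
Lemma spos_sqrt a e : spos a -> 0 < e ->
  exists w, [/\ star w = w, w * w = a + e%:C%:A &
    forall g, g * a = a * g -> g * w = w * g].
Proof.
move=> pa e0; have e2 : 0 < e / 2 by lra.
have [t [_ t0 ht]] := spos_large 0 pa e2.
have te : 0 < t + e by lra.
set h := (t + e)^-1%:C *: (t%:C%:A - a).
have hh : star h = h by rewrite (starZr hA) (star_sub hA) star_const (spos_herm pa).
have h1 : nrm h < 1.
  rewrite (nrmZr hA) ger0_norm ?invr_ge0 1?ltW // mulrC ltr_pdivrMr //; lra.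
have [w [hw ww wc]] := herm_sqrt hA hh h1.
exists ((Num.sqrt (t + e))%:C *: w); split.
- by rewrite (starZr hA) hw.
- rewrite -scalerAl -scalerAr scalerA -rmorphM -expr2 sqr_sqrtr ?(ltW te) // ww.
  rewrite scalerBr scalerA -rmorphM mulfV ?gt_eqF // rmorph1 scale1r constD.
  by nc_ring.
- move=> g ga; rewrite -scalerAl -scalerAr wc // /h -scalerAl -scalerAr.
  by rewrite mulrBl mulrBr ga -scalerAl -scalerAr mul1r mulr1.
Qed.

Section Unitary.
Variables v w : A.
Hypotheses (hv : star v = v) (hw : star w = w) (vw : v * w = w * v).

Lemma star_cartesian : star (v + I *: w) = v - I *: w.
Proof. by rewrite (starD hA) (starZi hA) hv hw. Qed.

Lemma star_mul_cartesian : star (v + I *: w) * (v + I *: w) = v * v + w * w.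
Proof.
rewrite star_cartesian mulrDr !mulrBl -!scalerAr -!scalerAl vw (scaleII (w * w)).
by nc_ring.
Qed.

Lemma sqr_cartesian_re :
  (v + I *: w) * (v + I *: w) + star ((v + I *: w) * (v + I *: w)) =
  (v * v - w * w) *+ 2.
Proof.
rewrite (starM hA) star_cartesian !(mulrDr, mulrBr) !(mulrDl, mulrBl).
rewrite !(mulrN, mulNr) !opprK -!scalerAr -!scalerAl vw (scaleII (w * w)).
by nc_ring.
Qed.
End Unitary.

Lemma nrmMn x n : nrm (x *+ n) = n%:R * nrm x.
Proof.
have -> : x *+ n = (n%:R : R)%:C *: x by rewrite rmorph_nat scaler_nat.
by rewrite (nrmZr hA) ger0_norm.
Qed.

(** After rescaling to [nrm h < 1], put [w = sqrt (1 - h^2)]. Then [u = h + i w] satisfies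
    [star u * u = 1], so [nrm u = 1] and its imaginary part [w] has norm at most one; hence
    [nrm (1 - h^2) <= 1], and [t = 1] is a witness. *)
Lemma spos_sqr h : star h = h -> spos (h * h).
Proof.
move=> hh; set r := nrm h + 1.
have r0 : 0 < r by have := nrm_ge0 hA h; rewrite /r; lra.
have hk : star (r^-1%:C *: h) = r^-1%:C *: h by rewrite (starZr hA) hh.
have k1 : nrm (r^-1%:C *: h) < 1.
  rewrite (nrmZr hA) ger0_norm ?invr_ge0 1?ltW // mulrC ltr_pdivrMr // /r; lra.
have -> : h * h = (r ^+ 2)%:C *: ((r^-1%:C *: h) * (r^-1%:C *: h)).
  rewrite -scalerAl -scalerAr !scalerA -!rmorphM.
  rewrite (_ : r ^+ 2 * r^-1 * r^-1 = 1); first by rewrite rmorph1 scale1r.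
  by field; rewrite gt_eqF.
apply: sposZ; first exact: sqr_ge0.
(* From here on [h] denotes the rescaled element. *)
move: (_ *: h) hk k1 => {hh r r0} {}h hh h1.
have hh1 : nrm (h * h) < 1.
  by rewrite (nrm_sq hA) // expr_lt1 // (nrm_ge0 hA).
have hhh : star (h * h) = h * h by rewrite (starM hA) hh.
have [w [hw ww wc]] := herm_sqrt hA hhh hh1.
have hwc : h * w = w * h by apply: wc; rewrite mulrA.
have := star_mul_cartesian hh hw hwc; set u := h + I *: w => uu.
have nu : nrm u = 1.
  have : nrm u ^+ 2 = 1 by rewrite -(nrm_cstar hA) uu ww addrC subrK (nrm1 hA).
  by move=> /eqP; rewrite sqrp_eq1 ?(nrm_ge0 hA) // => /eqP.
have nw : nrm w <= 1.
  have -> : w = (2^-1 : R)%:C *: (I *: (star u - u)).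
    rewrite star_cartesian // /u opprD addrACA subrr add0r -opprD -scalerDr.
    rewrite scalerN (scaleII (w + w)) opprK scalerDr -scalerDl -rmorphD.
    by rewrite (_ : 2^-1 + 2^-1 = 1 :> R) ?rmorph1 ?scale1r //; lra.
  rewrite (nrmZr hA) (nrmZi hA) ger0_norm ?invr_ge0 ?ler0n //.
  by have := nrmB hA (star u) u; rewrite (nrm_star hA) nu; lra.
split=> // e e0; exists 1 => //; rewrite const1 -ww (nrm_sq hA) //.
have : nrm w ^+ 2 <= 1 by rewrite expr_le1 // (nrm_ge0 hA).
by lra.
Qed.

(** With [v^2 = s + h + e], [w^2 = s - h + e] and [u = v + i w], one has [star u * u = 2 (s + e)]
    and [u^2 + star (u^2) = 4 h]. Hence [4 nrm h <= 2 (nrm u)^2 = 4 (s + e)]. *)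
Lemma spos_bound s h : 0 <= s -> star h = h ->
  spos (s%:C%:A - h) -> spos (s%:C%:A + h) -> nrm h <= s.
Proof.
move=> s0 hh pm pp; apply/ler_addgt0Pr => e e0.
have [v [hv vv vc]] := spos_sqrt pp e0; have [w [hw ww wc]] := spos_sqrt pm e0.
have vw : v * w = w * v.
  (* [s - h] commutes with [s + h], hence with the root [v]; so [v] commutes with [s - h], hence
     with the root [w]. *)
  apply: wc; apply/esym/vc.
  by rewrite !mulrDl !mulrDr !mulrN !mulNr -!scalerAl -!scalerAr !mul1r !mulr1; nc_ring.
have := star_mul_cartesian hv hw vw; have := sqr_cartesian_re hv hw vw.
set u := v + I *: w; rewrite vv ww => h1 h2.
have nu : nrm u ^+ 2 = (s + e) * 2.
  rewrite -(nrm_cstar hA) h2.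
  have -> : s%:C%:A + h + e%:C%:A + (s%:C%:A - h + e%:C%:A) = (s + e)%:C%:A *+ 2 :> A.
    by rewrite constD; nc_ring.
  by rewrite nrmMn nrm_const ger0_norm; [rewrite mulrC|lra].
have : nrm (h *+ 4) <= nrm u ^+ 2 *+ 2.
  have -> : h *+ 4 = u * u + star (u * u) by rewrite h1 -[4%N]/(2 * 2)%N mulrnA; nc_ring.
  apply: le_trans (nrmD hA _ _) _; rewrite (nrm_star hA) -mulr2n lerMn2r /= expr2.
  exact: (nrmM hA).
by rewrite nrmMn nu; lra.
Qed.

(** Stands in for the equality of the nonzero spectra of [y * star y] and [star y * y]. The powers
    of [s - star y * y] are [s^n - star y * q * y], where [q] is built from powers of
    [s - y * star y], so their norms are at most [tau^n] times a linear function of [n]; by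
    [growth_le1] the linear factor disappears. *)
Lemma spos_swap y (eta : R) : 0 <= eta ->
  spos (y * star y + eta%:C%:A) -> spos (star y * y + eta%:C%:A).
Proof.
move=> eta0 pos; split.
  by rewrite (starD hA) (starM hA) (starK hA) star_const.
(* Asking for [eta <= t] makes [s = t - eta] nonnegative, so that [tau] bounds [|s|] as well. *)
move=> e e0; have [t [ht t0]] := spos_large eta pos e0.
set tau := t + e; set s := t - eta.
have tau0 : 0 < tau by rewrite /tau; lra.
have -> : t%:C%:A - (y * star y + eta%:C%:A) = s%:C%:A - y * star y.
  by rewrite /s constD constN; nc_ring.
move=> hs; exists t => //.
have -> : t%:C%:A - (star y * y + eta%:C%:A) = s%:C%:A - star y * y.
  by rewrite /s constD constN; nc_ring.
set d := s%:C%:A - star y * y.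
have hd : star d = d by rewrite (star_sub hA) (starM hA) (starK hA) star_const.
have s_le : `|s| <= tau by rewrite ger0_norm /s /tau; lra.
have pw n : exists q, d ^+ n = (s ^+ n)%:C%:A - star y * q * y /\
    tau * nrm q <= n%:R * tau ^+ n.
  elim: n => [|n [q [dq nq]]].
    exists 0; rewrite mulr0 mul0r !expr0 const1 subr0 (nrm0 hA).
    by split=> //; lra.
  exists ((s ^+ n)%:C%:A + (s%:C%:A - y * star y) * q); split.
    rewrite exprS dq /d [in RHS]exprS rmorphM -scalerA.
    rewrite !(mulrBl, mulrBr, mulrDl, mulrDr) -!(scalerAl, scalerAr) !mul1r !mulr1.
    by rewrite !mulrA; nc_ring.
  have := nrmD hA (s ^+ n)%:C%:A ((s%:C%:A - y * star y) * q).
  rewrite nrm_const normrX.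
  have h1 := nrmM hA (s%:C%:A - y * star y) q.
  have h2 : `|s| ^+ n <= tau ^+ n by rewrite lerXn2r ?nnegrE // ltW.
  have h3 : nrm (s%:C%:A - y * star y) * nrm q <= tau * nrm q.
    by rewrite ler_wpM2r ?(nrm_ge0 hA).
  move=> h4; rewrite exprS -natr1 mulrCA ler_pM2l //.
  by rewrite [(_ + 1) * _]mulrDl mul1r; lra.
have nd n : nrm d ^+ n * tau <= tau ^+ n * (tau + n%:R * nrm y ^+ 2).
  have [q [dq nq]] := pw n; rewrite -(nrmX hA) // dq.
  have h1 := nrmB hA (s ^+ n)%:C%:A (star y * q * y).
  have h2 := nrmM hA (star y * q) y; have h3 := nrmM hA (star y) q.
  rewrite (nrm_star hA) in h3; rewrite nrm_const normrX in h1.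
  have h4 : `|s| ^+ n <= tau ^+ n by rewrite lerXn2r ?nnegrE // ltW.
  have h5 : nrm (star y * q * y) <= nrm y ^+ 2 * nrm q.
    apply: le_trans h2 _; apply: le_trans (ler_wpM2r (nrm_ge0 hA _) h3) _.
    by rewrite expr2 mulrAC.
  have h6 : nrm y ^+ 2 * (tau * nrm q) <= nrm y ^+ 2 * (n%:R * tau ^+ n).
    by rewrite ler_wpM2l // sqr_ge0.
  have h7 : nrm ((s ^+ n)%:C%:A - star y * q * y) * tau
     <= (tau ^+ n + nrm y ^+ 2 * nrm q) * tau by rewrite ler_pM2r //; lra.
  apply: le_trans h7 _.
  have -> : (tau ^+ n + nrm y ^+ 2 * nrm q) * tau =
    tau ^+ n * tau + nrm y ^+ 2 * (tau * nrm q) by ring.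
  have -> : tau ^+ n * (tau + n%:R * nrm y ^+ 2) =
    tau ^+ n * tau + nrm y ^+ 2 * (n%:R * tau ^+ n) by ring.
  by rewrite lerD2l.
rewrite -[leRHS]mul1r -ler_pdivrMr //.
apply: (@growth_le1 _ _ (nrm y ^+ 2 / tau)) => n.
rewrite expr_div_n ler_pdivrMr ?exprn_gt0 // -(ler_pM2r tau0).
apply: le_trans (nd n) _; rewrite le_eqVlt; apply/orP; left; apply/eqP.
by field; rewrite gt_eqF.
Qed.

(** For [b = w^2] this is [M b^M (1 - b) <= 1 - b^M]. Passing from [M] to [M + 1] adds
    [(M + 1) b^M (1 - b)^2], a multiple of the hermitian square of [w^M (1 - b)]. *)
Lemma spos_bernstein w M : star w = w ->
  spos (1 - (w * w) ^+ M *+ M.+1 + (w * w) ^+ M.+1 *+ M).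
Proof.
move=> hw; elim: M => [|M IH].
  by rewrite expr0 mulr1n mulr0n addr0 subrr; exact: spos0.
set b := w * w in IH *.
have wb : GRing.comm (w ^+ M) (1 - b).
  by apply: commrB; [exact: commr1|apply/commr_sym/commrX/commr_sym; rewrite /GRing.comm /b mulrA].
have hz : star (w ^+ M * (1 - b)) = w ^+ M * (1 - b).
  by rewrite (starM hA) (starX hA) (star_sub hA) (star1 hA) (starM hA) hw wb.
have := sposD IH (sposMn M.+1 (spos_sqr hz)).
suff -> : w ^+ M * (1 - b) * (w ^+ M * (1 - b)) = (1 - b) * (1 - b) * b ^+ M.
  congr spos; rewrite !exprS; set p := b ^+ M.
  rewrite -!mulrnAr !mulrS; set q := p *+ M.
  by nc_ring.
rewrite [b ^+ M]exprMn_comm // wb -[LHS]mulrA [w ^+ M * _]mulrA wb.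
by rewrite !mulrA.
Qed.

(** Half the sum of the squares of the hermitian elements [y + star y] and [i (y - star y)]. *)
Lemma spos_jordan y : spos (star y * y + y * star y).
Proof.
have h1 : star (y + star y) = y + star y by rewrite (starD hA) (starK hA) addrC.
have h2 : star (I *: (y - star y)) = I *: (y - star y).
  by rewrite (starZi hA) (star_sub hA) (starK hA) -scalerN opprB.
have h3 : (0 : R) <= 2^-1 by rewrite invr_ge0.
have := sposZ h3 (sposD (spos_sqr h1) (spos_sqr h2)); congr spos.
rewrite -scalerAl -scalerAr scaleII.
have -> : (y + star y) * (y + star y) - (y - star y) * (y - star y) =
  (star y * y + y * star y) *+ 2 by nc_ring.
rewrite -scaler_nat -(rmorph_nat (real_complex R)) scalerA -rmorphM.
by rewrite mulVf ?pnatr_eq0 // rmorph1 scale1r.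
Qed.

(* Replaces the negative part of [a = x^* x] in the classical argument: with [b = 1 - a],
   [y = x b^N] satisfies [y^* y = a b^(2 N) <= 1 / (2 N)], so [y y^*], hence [y^* y], is at
   least [- 1 / (2 N)]; thus [nrm (a b^(2 N)) <= 1 / (2 N)], which forces [nrm b <= 1]. *)
Lemma spos_star_mul_small x : nrm x < 1 -> spos (star x * x).
Proof.
move=> x1; set a := star x * x.
have ha : star a = a by rewrite (starM hA) (starK hA).
have a1 : nrm a < 1 by rewrite (nrm_cstar hA) expr_lt1 // (nrm_ge0 hA).
have [w [hw ww _]] := herm_sqrt hA ha a1; set b := 1 - a in ww.
have hb : star b = b by rewrite (star_sub hA) (star1 hA) ha.
have ab : a = 1 - b by rewrite /b opprB addrC subrK.
have key N : (0 < N)%N -> nrm b ^+ (N * 2) * (nrm b - 1) <= (N * 2)%:R^-1.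
  move=> N0; set M := (N * 2)%N; have M0 : (0 : R) < M%:R by rewrite ltr0n muln_gt0 N0.
  set eta := M%:R^-1; have eta0 : 0 <= eta by rewrite invr_ge0 ltW.
  set y := x * b ^+ N.
  have yy : star y * y = b ^+ M - b ^+ M.+1.
    rewrite (starM hA) (starX hA) hb mulrA -(mulrA _ (star x)) -/a ab.
    rewrite mulrBr mulrBl mulr1 -exprSr -!exprD addSn /M muln2 addnn //.
  (* [1 - M star y * y] is the expression of [spos_bernstein] plus [b^M]; the even exponent
     [M = 2 N] makes [b^M] the square of [b^N]. *)
  have p1 : spos (eta%:C%:A - star y * y).
    have -> : eta%:C%:A - star y * y = eta%:C *: (1 - (star y * y) *+ M).
      rewrite scalerBr; congr (_ - _).
      rewrite -scaler_nat -(rmorph_nat (real_complex R)) scalerA -rmorphM.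
      by rewrite mulVf ?gt_eqF // rmorph1 scale1r.
    apply: sposZ => //; have hbN : star (b ^+ N) = b ^+ N by rewrite (starX hA) hb.
    have := sposD (spos_bernstein M hw) (spos_sqr hbN); congr spos.
    by rewrite ww yy mulrnBl -exprD addnn -muln2 -/M mulrSr; nc_ring.
  have p2 : spos (star y * y + eta%:C%:A).
    apply: spos_swap => //.
    (* [y * star y + eta] is the sum of [eta - star y * y] and [star y * y + y * star y]. *)
    have := sposD p1 (spos_jordan y); congr spos; nc_ring.
  have hyy : star (star y * y) = star y * y by rewrite (starM hA) (starK hA).
  have := spos_bound eta0 hyy p1; rewrite [_ + star y * y]addrC => /(_ p2).
  rewrite yy => h.
  have : nrm (b ^+ M.+1) <= nrm (b ^+ M) + nrm (b ^+ M - b ^+ M.+1).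
    by have := nrmB hA (b ^+ M) (b ^+ M - b ^+ M.+1); rewrite opprB addrCA subrr addr0.
  by rewrite !(nrmX hA) // exprSr; lra.
have b1 : nrm b <= 1.
  rewrite leNgt; apply/negP => b1; have d0 : 0 < nrm b - 1 by lra.
  have [N hN] := exists_nat_gt (nrm b - 1)^-1.
  have N0 : (0 < N)%N by rewrite -(ltr0n R); apply: lt_trans hN; rewrite invr_gt0.
  have Np : (0 : R) < N%:R by rewrite ltr0n.
  have := key N N0; apply/negP; rewrite -ltNge.
  have h1 : nrm b - 1 <= nrm b ^+ (N * 2) * (nrm b - 1).
    by rewrite ler_peMl ?(ltW d0) // exprn_ege1 // ltW.
  apply: lt_le_trans h1; rewrite -[ltRHS]invrK ltf_pV2 ?posrE ?invr_gt0 //.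
    apply: lt_le_trans hN _; rewrite ler_nat; exact: leq_pmulr.
  by rewrite ltr0n muln_gt0 N0.
by split=> // e e0; exists 1 => //; rewrite const1; lra.
Qed.

Lemma spos_star_mul x : spos (star x * x).
Proof.
set r := nrm x + 1; have r0 : 0 < r by have := nrm_ge0 hA x; rewrite /r; lra.
have k1 : nrm (r^-1%:C *: x) < 1.
  rewrite (nrmZr hA) ger0_norm ?invr_ge0 1?ltW // mulrC ltr_pdivrMr // /r; lra.
have := sposZ (sqr_ge0 r) (spos_star_mul_small k1); congr spos.
rewrite (starZr hA) -scalerAl -scalerAr !scalerA -!rmorphM.
rewrite (_ : _ * _ = 1) ?rmorph1 ?scale1r //.
by field; rewrite gt_eqF.
Qed.

End SpectralPositivity.

(** * Separation by maximal cones *)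

Section Cones.
Local Open Scope classical_set_scope.
Variables (R : realType) (V : lmodType R[i]).
Implicit Types (K C X : set V) (x y e h : V) (c s t : R).

Definition cone C := (forall x y, C x -> C y -> C (x + y)) /\
  (forall c x, 0 <= c -> C x -> C (c%:C *: x)).

Lemma cone_adjoin C x : cone C -> C 0 ->
  let Y := [set z | exists c y, [/\ 0 <= c, C y & z = y + c%:C *: x]] in
  [/\ cone Y, C `<=` Y & Y x].
Proof.
move=> [CD CZ] C0 /=; split; first split.
- move=> _ _ [a [y [a0 Cy ->]]] [b [z [b0 Cz ->]]]; exists (a + b), (y + z); split.
  + by rewrite addr_ge0.
  + exact: CD.
  + by rewrite rmorphD scalerDl addrACA.
- move=> c _ c0 [a [y [a0 Cy ->]]]; exists (c * a), (c%:C *: y); split.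
  + by rewrite mulr_ge0.
  + exact: CZ.
  + by rewrite scalerDr scalerA rmorphM.
- by move=> y Cy; exists 0, y; rewrite rmorph0 scale0r addr0.
- by exists 1, 0; rewrite rmorph1 scale1r add0r.
Qed.

(** Zorn's lemma is applied to sets [X] through [K] united with [X], so that the empty chain is
    covered too. If a maximal cone missed both [x] and [- x], adjoining either would produce [- e],
    and eliminating [x] from the two expressions would put [- e] in the cone. *)
Lemma maximal_cone K e : cone K -> K 0 -> ~ K (- e) ->
  exists C, [/\ cone C, K `<=` C, ~ C (- e) & forall x, C x \/ C (- x)].
Proof.
move=> cK K0 Ke.
pose P X := cone (K `|` X) /\ ~ (K `|` X) (- e).
have [F FP Ftot|X [[cX Xe] maxX]] := @Zorn_bigcup V P.
  split; last first.
    move=> [//|[X FX Xe]]; have [_] := FP _ FX; apply; by right.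
  split.
  - move=> x y [Kx|[X FX Xx]] [Ky|[Y FY Yy]].
    + by left; apply: cK.1.
    + have [[YD _] _] := FP _ FY.
      by case: (YD x y (or_introl Kx) (or_intror Yy)); [left|right; exists Y].
    + have [[XD _] _] := FP _ FX.
      by case: (XD x y (or_intror Xx) (or_introl Ky)); [left|right; exists X].
    + case: (Ftot _ _ FX FY) => sub.
        have [[YD _] _] := FP _ FY.
        by case: (YD x y (or_intror (sub _ Xx)) (or_intror Yy)); [left|right; exists Y].
      have [[XD _] _] := FP _ FX.
      by case: (XD x y (or_intror Xx) (or_intror (sub _ Yy))); [left|right; exists X].
  - move=> c x c0 [Kx|[X FX Xx]]; first by left; apply: cK.2.
    have [[_ XZ] _] := FP _ FX.
    by case: (XZ c x c0 (or_intror Xx)); [left|right; exists X].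
set C := K `|` X in cX Xe; have C0 : C 0 by left.
have adj x : ~ C x -> exists c y, [/\ 0 <= c, C y & - e = y + c%:C *: x].
  move=> nCx; apply: contrapT => nY.
  have [] := cone_adjoin x cX C0; set Y := [set z | _] => cY CY Yx.
  have KY : K `|` Y = Y by apply/setUidPr => z Kz; apply: CY; left.
  apply: (maxX Y); last by rewrite /P KY.
  split; first by move=> z Xz; apply: CY; right.
  by move=> YX; apply: nCx; right; apply: YX.
exists C; split => // [x Kx|x]; first by left.
have [//|Cx] := pselect (C x); first by left.
have [//|CNx] := pselect (C (- x)); first by right.
have [a [y [a0 Cy ey]]] := adj _ Cx; have [b [z [b0 Cz ez]]] := adj _ CNx.
exfalso; apply: (Xe).
have bn0 : b != 0.
  by apply/eqP => b0'; apply: Xe; rewrite ez b0' rmorph0 scale0r addr0.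
have ab : 0 < a + b by rewrite ltr_wpDl // lt_neqAle eq_sym bn0.
(* [b] times [- e = y + a x] plus [a] times [- e = z - b x] cancels [x]. *)
have -> : - e = (a + b)^-1%:C *: (b%:C *: y + a%:C *: z).
  have -> : b%:C *: y + a%:C *: z = (a + b)%:C *: (- e).
    rewrite rmorphD scalerDl {1}ez ey !scalerDr !scalerN !scalerA [b%:C * _]mulrC.
    by rewrite addrACA addNr addr0 addrC.
  by rewrite scalerA -rmorphM mulVf ?gt_eqF // rmorph1 scale1r.
apply: cX.2; first by rewrite invr_ge0 ltW.
by apply: cX.1; apply: cX.2.
Qed.

(* The cone [K] together with [h - t0 e] is enlarged to a maximal cone omitting [- e];
   such a cone is a half-space, and the functional is read off from it. *)
Lemma separating_functional K e h t0 : cone K -> K e ->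
  (forall x, exists t, K (t%:C *: e - x)) -> ~ K (- e) -> ~ K (t0%:C *: e - h) ->
  exists f : V -> R, [/\ forall x y, f (x + y) = f x + f y,
    forall c x, f (c%:C *: x) = c * f x, f e = 1,
    forall x, K x -> 0 <= f x & t0 <= f h].
Proof.
move=> cK Ke unit Kne Kh.
have K0 : K 0 by rewrite -(scale0r e) -(rmorph0 (real_complex R)); apply: cK.2.
have [] := cone_adjoin (h - t0%:C *: e) cK K0; set Y := [set z | _] => cY KY Yh.
(* If [- e = y + c (h - t0 e)] with [c > 0], then [t0 e - h = (y + e) / c] would lie in [K]. *)
have Ye : ~ Y (- e).
  move=> [c [y [c0 Ky ey]]]; have [c00|cn0] := eqVneq c 0.
    by apply: Kne; rewrite ey c00 rmorph0 scale0r addr0.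
  have cp : 0 < c by rewrite lt_neqAle eq_sym cn0.
  apply: Kh; have -> : t0%:C *: e - h = c^-1%:C *: (y + e).
    have -> : y + e = c%:C *: (t0%:C *: e - h).
      rewrite -(opprB h) scalerN; apply/eqP; rewrite -addr_eq0 addrAC -ey.
      by rewrite addNr.
    by rewrite scalerA -rmorphM mulVf // rmorph1 scale1r.
  by apply: cK.2; [rewrite invr_ge0|apply: cK.1].
have [C [[CD CZ] YC Ce tot]] := maximal_cone cY (KY _ K0) Ye.
have Cge0 c : C (c%:C *: e) -> 0 <= c.
  move=> Cc; rewrite leNgt; apply/negP => c0; apply: Ce.
  have -> : - e = (- c^-1)%:C *: (c%:C *: e).
    by rewrite scalerA -rmorphM mulNr mulVf ?lt_eqF // rmorphN rmorph1 scaleN1r.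
  by apply: CZ => //; rewrite oppr_ge0 invr_le0 ltW.
have Cle x s t : C (s%:C *: e - x) -> C (x - t%:C *: e) -> t <= s.
  move=> h1 h2; rewrite -subr_ge0; apply: Cge0.
  by rewrite rmorphB scalerBl -(subrKA x); apply: CD.
(* The graph of the functional: [x] is squeezed between [(v - d) e] and [(v + d) e]. The margin [d]
   is there because [C] need not be closed. *)
pose D x (v : R) := forall d : R, 0 < d -> C ((v + d)%:C *: e - x) /\ C (x - (v - d)%:C *: e).
have Duniq x v w : D x v -> D x w -> v = w.
  move=> Dv Dw; apply/eqP; rewrite eq_le; apply/andP; split.
    apply/ler_addgt0Pr => d d0; have d2 : 0 < d / 2 by lra.
    by have := Cle _ _ _ (Dw _ d2).1 (Dv _ d2).2; lra.
  apply/ler_addgt0Pr => d d0; have d2 : 0 < d / 2 by lra.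
  by have := Cle _ _ _ (Dv _ d2).1 (Dw _ d2).2; lra.
have DD x y v w : D x v -> D y w -> D (x + y) (v + w).
  move=> Dv Dw d d0; have d2 : 0 < d / 2 by lra.
  have [v1 v2] := Dv _ d2; have [w1 w2] := Dw _ d2; split.
    have := CD _ _ v1 w1; congr C; rewrite opprD addrACA -scalerDl -rmorphD.
    by congr (_%:C *: _ + _); lra.
  have := CD _ _ v2 w2; congr C; rewrite addrACA -opprD -scalerDl -rmorphD.
  by congr (_ - _%:C *: _); lra.
have DN x v : D x v -> D (- x) (- v).
  move=> Dv d d0; have [v1 v2] := Dv _ d0; split.
    move: v2; congr C; rewrite opprK addrC -scaleNr -rmorphN.
    by congr (_%:C *: _ + _); lra.
  move: v1; congr C; rewrite addrC -scaleNr -rmorphN.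
  by congr (_ + _%:C *: _); lra.
have DZ c x v : 0 <= c -> D x v -> D (c%:C *: x) (c * v).
  (* The denominator [c + 1] also covers [c = 0]. *)
  move=> c0 Dv d d0; have d2 : 0 < d / (c + 1) by rewrite divr_gt0 //; lra.
  have cd : c * (d / (c + 1)) <= d.
    by rewrite mulrCA ger_pMr // ler_pdivrMr; lra.
  have Cd : C ((d - c * (d / (c + 1)))%:C *: e).
    by apply: CZ; [rewrite subr_ge0|apply/YC/KY].
  have [v1 v2] := Dv _ d2; split.
    have := CD _ _ Cd (CZ _ _ c0 v1); congr C; rewrite scalerBr addrA scalerA.
    by rewrite -rmorphM -scalerDl -rmorphD; congr (_%:C *: _ + _); ring.
  have := CD _ _ Cd (CZ _ _ c0 v2); congr C; rewrite scalerBr addrCA scalerA.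
  rewrite -rmorphM -scalerBl -rmorphB -scaleNr -rmorphN.
  by congr (_ + _%:C *: _); ring.
have Dex x : exists v, D x v.
  pose S := [set t | C (t%:C *: e - x)].
  have [t1 Kt1] := unit x; have [t2 Kt2] := unit (- x).
  have Ct2 : C (x - (- t2)%:C *: e).
    by apply: YC; apply: KY; move: Kt2; rewrite opprK rmorphN scaleNr opprK addrC.
  have hinf : has_inf S.
    split; first by exists t1; apply: YC; apply: KY.
    by exists (- t2) => t St; exact: Cle St Ct2.
  exists (inf S) => d d0; split.
    have [t St td] := inf_adherent d0 hinf.
    have Cd : C ((inf S + d - t)%:C *: e).
      by apply: CZ; [rewrite subr_ge0 ltW|apply/YC/KY].
    have := CD _ _ Cd St; congr C; rewrite addrA -scalerDl -rmorphD subrK.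
    by [].
  (* Were the opposite element in [C], [inf S - d] would belong to [S]. *)
  case: (tot (x - (inf S - d)%:C *: e)) => //; rewrite opprB => Sd.
  have := inf_lbound hinf.2 Sd; lra.
have [f Df] : exists f : V -> R, forall x, D x (f x).
  by have [f fP] := choice Dex; exists f.
exists f; split.
- by move=> x y; apply: Duniq (Df _) (DD _ _ _ _ (Df _) (Df _)).
- move=> c x; have [c0|c0] := leP 0 c; first by apply: Duniq (Df _) (DZ _ _ _ c0 (Df _)).
  apply: Duniq (Df _) _; have c0' : 0 <= - c by lra.
  have := DN _ _ (DZ _ _ _ c0' (Df x)); rewrite rmorphN scaleNr opprK.
  by rewrite mulNr opprK.
- apply: Duniq (Df _) _ => d d0.
  have Cd : C (d%:C *: e) by apply: CZ; [rewrite ltW|apply/YC/KY].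
  split; move: Cd; congr C.
    by rewrite rmorphD rmorph1 scalerDl scale1r addrAC subrr add0r.
  by rewrite rmorphB rmorph1 scalerBl scale1r opprB addrCA subrr addr0.
- move=> x Kx; apply/ler_addgt0Pr => d d0; apply: (Cle x _ 0 (Df x _ d0).1).
  by rewrite rmorph0 scale0r subr0; apply: YC; apply: KY.
- by apply/ler_addgt0Pr => d d0; apply: Cle (Df h _ d0).1 (YC _ Yh).
Qed.

End Cones.

(** * States *)

Section States.
Local Open Scope classical_set_scope.
Variables (R : realType) (A : algType R[i]) (star : A -> A) (nrm : A -> R).
Hypothesis hA : is_cstar_alg star nrm.
Local Notation I := ('i%C : R[i]).
Local Notation Re := (@complex.Re R).
Local Notation Im := (@complex.Im R).
Implicit Types (x y p h : A) (r s t e : R) (phi : A -> R[i]).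

Section StateTheory.
Variable phi : A -> R[i].
Hypothesis hphi : is_state star phi.

Lemma state1 : phi 1 = 1.
Proof. by case: hphi. Qed.

Lemma stateD x y : phi (x + y) = phi x + phi y.
Proof. by case: hphi => + _ _ => /(_ 1 x y); rewrite scale1r mul1r. Qed.

Lemma state0 : phi 0 = 0.
Proof. by have /eqP := stateD 0 0; rewrite addr0 -{1}[phi 0]addr0 (inj_eq (addrI _)) => /eqP <-. Qed.

Lemma stateZ (c : R[i]) x : phi (c *: x) = c * phi x.
Proof. by case: hphi => + _ _ => /(_ c x 0); rewrite !addr0 state0 addr0. Qed.

Lemma stateN x : phi (- x) = - phi x.
Proof. by rewrite -[- x]scaleN1r stateZ mulN1r. Qed.

Lemma stateB x y : phi (x - y) = phi x - phi y.
Proof. by rewrite stateD stateN. Qed.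

Lemma state_sqr_ge0 h : star h = h -> 0 <= phi (h * h).
Proof. by move=> hh; case: hphi => _ + _ => /(_ h); rewrite hh. Qed.

(** [4 p = (p + 1)^2 - (p - 1)^2] is a difference of hermitian squares, on which a state is real. *)
Lemma state_herm_im p : star p = p -> Im (phi p) = 0.
Proof.
move=> hp.
have h1 : star (p + 1) = p + 1 by rewrite (starD hA) hp (star1 hA).
have h2 : star (p - 1) = p - 1 by rewrite (star_sub hA) hp (star1 hA).
have i1 := ger0_Im (state_sqr_ge0 h1); have i2 := ger0_Im (state_sqr_ge0 h2).
have e : (p + 1) * (p + 1) - (p - 1) * (p - 1) = p *+ 4.
  by rewrite -[4%N]/(2 * 2)%N mulrnA; nc_ring.
have := congr1 (fun x => Im (phi x)) e; rewrite /= stateB -scaler_nat stateZ.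
rewrite raddfB /= i1 i2 subrr -(rmorph_nat (real_complex R)) /=.
by case: (phi p) => a b /=; rewrite mul0r addr0; lra.
Qed.

Lemma state_star x : phi (star x) = (phi x)^*.
Proof.
have h1 : star (x + star x) = x + star x by rewrite (starD hA) (starK hA) addrC.
have h2 : star (I *: (x - star x)) = I *: (x - star x).
  by rewrite (starZi hA) (star_sub hA) (starK hA) -scalerN opprB.
have := state_herm_im h1; have := state_herm_im h2.
rewrite stateZ stateB stateD -[(phi x)^*]/(conjc (phi x)).
case: (phi x) (phi (star x)) => a b [c d] /= e1 e2.
by apply/eqP; rewrite eq_complex /=; apply/andP; split; apply/eqP; lra.
Qed.

(** [nrm p - p + e] is a hermitian square for every [e > 0]. *)
Lemma state_herm_le p : star p = p -> Re (phi p) <= nrm p.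
Proof.
move=> hp; apply/ler_addgt0Pr => e e0.
have [w [hw ww _]] := spos_sqrt hA (spos_nrm_sub hA hp) e0.
have := state_sqr_ge0 hw; rewrite ww stateD stateB !stateZ state1 !mulr1.
by rewrite lecE => /andP[_]; case: (phi p) => a b /=; lra.
Qed.

Lemma state_Re_le x : Re (phi x) <= nrm x.
Proof.
have h1 : star (x + star x) = x + star x by rewrite (starD hA) (starK hA) addrC.
have := state_herm_le h1; rewrite stateD state_star -[(phi x)^*]/(conjc (phi x)).
have := nrmD hA x (star x); rewrite (nrm_star hA).
by case: (phi x) => a b /=; lra.
Qed.

(** The factor two comes from bounding real and imaginary parts separately. It suffices to bound the
    set defining [numrad], so that its [sup] is a true supremum. *)
Lemma state_cabs_le x : cabs (phi x) <= nrm x *+ 2.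
Proof.
have n0 := nrm_ge0 hA x.
suff: cabs (phi x) ^+ 2 <= (nrm x *+ 2) ^+ 2.
  by rewrite ler_sqr ?nnegrE ?mulrn_wge0 ?cabs_ge0.
have h1 := state_Re_le x; have h2 := state_Re_le (- x).
have h3 := state_Re_le (I *: x); have h4 := state_Re_le (- (I *: x)).
move: h1 h2 h3 h4; rewrite !(nrmN hA) (nrmZi hA) !stateN stateZ.
rewrite cabs_sqr.
case: (phi x) => a b /=; rewrite !mul0r !mul1r add0r => *.
have ha : a ^+ 2 <= nrm x ^+ 2 by rewrite -real_normK ?num_real // lerXn2r ?nnegrE // ler_norml; lra.
have hb : b ^+ 2 <= nrm x ^+ 2 by rewrite -real_normK ?num_real // lerXn2r ?nnegrE // ler_norml; lra.
have : 0 <= nrm x ^+ 2 by exact: sqr_ge0.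
rewrite -mulr_natr exprMn; lra.
Qed.

End StateTheory.

Lemma state_le_numrad phi x : is_state star phi -> cabs (phi x) <= numrad star x.
Proof.
move=> hphi; apply: ub_le_sup; last by exists phi.
by exists (nrm x *+ 2) => _ [psi [hpsi ->]]; exact: state_cabs_le.
Qed.

(** The hypothesis [0 <= C] covers an empty set of states, whose [sup] is [0] by convention. *)
Lemma numrad_le x (C : R) : 0 <= C ->
  (forall phi, is_state star phi -> cabs (phi x) <= C) -> numrad star x <= C.
Proof.
move=> C0 hC; rewrite /numrad; set S := [set _ | _].
have [->|/set0P [r Sr]] := eqVneq S set0; first by rewrite sup0.
apply: ge_sup; first by exists r.
by move=> _ [phi [hphi ->]]; exact: hC.
Qed.

Lemma numrad0 : numrad star 0 = 0.
Proof.
apply/eqP; rewrite eq_le; apply/andP; split.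
  apply: numrad_le => // phi hphi.
  by rewrite (state0 hphi) -(rmorph0 (real_complex R)) cabs_real normr0.
rewrite /numrad; set S := [set _ | _].
have [->|] := eqVneq S set0; first by rewrite sup0.
move=> /set0P [_ [phi [hphi _]]].
exact: le_trans (cabs_ge0 _) (state_le_numrad 0 hphi).
Qed.

(** Separation is applied to the real cone of elements with positive real part. The resulting
    functional [f] is real linear with [t0 <= f h], and [f x - i f (i x)] is its
    complexification. *)
Lemma state_of_not_spos h t0 : star h = h -> 0 < t0 -> ~ spos star nrm (t0%:C%:A - h) ->
  exists2 phi, is_state star phi & phi h != 0.
Proof.
move=> hh t00 nh.
pose K := [set x | spos star nrm (x + star x)].
have dbl x : star x = x -> K x <-> spos star nrm x.
  move=> hx; rewrite /K /= hx; split=> [p|p]; last exact: (sposD hA).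
  have half : (0 : R) <= 2^-1 by rewrite invr_ge0.
  have := sposZ hA half p; rewrite scalerDr -scalerDl -rmorphD.
  by rewrite (_ : 2^-1 + 2^-1 = 1 :> R) ?rmorph1 ?scale1r //; lra.
have cK : cone K.
  split=> [x y Kx Ky|c x c0 Kx]; rewrite /K /=.
    by rewrite (starD hA) addrACA; apply: (sposD hA).
  by rewrite (starZr hA) -scalerDr; apply: (sposZ hA).
have K1 : K 1.
  by apply/dbl; [exact: (star1 hA)|rewrite -const1; apply: (spos_const hA)].
have Kunit x : exists t, K (t%:C%:A - x).
  have hx : star (x + star x) = x + star x by rewrite (starD hA) (starK hA) addrC.
  exists (nrm (x + star x) / 2); rewrite /K /=.
  have := spos_nrm_sub hA hx; congr spos.
  rewrite (star_sub hA) (star_const hA) addrACA -constD -opprD; congr (_%:C%:A - _); lra.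
have Kn1 : ~ K (- 1).
  move=> /dbl; rewrite (starN hA) (star1 hA) => /(_ erefl).
  by rewrite -const1 -constN => /(spos_const_ge0 hA); lra.
have Kh : ~ K (t0%:C%:A - h).
  by move=> /dbl; rewrite (star_sub hA) (star_const hA) hh => /(_ erefl).
have [f [fD fZ f1 fK fh]] := separating_functional cK K1 Kunit Kn1 Kh.
(* Both [i p] and [- i p] have real part zero, hence lie in [K]. *)
have fI p : star p = p -> f (I *: p) = 0.
  move=> hp; have Ki : K (I *: p) by rewrite /K /= (starZi hA) hp subrr; apply: (spos0 hA).
  have Kmi : K ((-1 : R)%:C *: (I *: p)).
    by rewrite /K /= (starZr hA) (starZi hA) hp -scalerDr subrr scaler0; apply: (spos0 hA).
  by have := fK _ Ki; have := fK _ Kmi; rewrite fZ; lra.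
exists (fun x => (f x +i* - f (I *: x))%C); first split.
- move=> [s t] x y.
  have fa : f ((s +i* t)%C *: x) = s * f x + t * f (I *: x).
    rewrite [(s +i* t)%C]complexE /= scalerDl mulrC -scalerA fD !fZ; by [].
  have fia : f (I *: ((s +i* t)%C *: x)) = s * f (I *: x) - t * f x.
    rewrite scalerA mulrC -scalerA [(s +i* t)%C]complexE /= scalerDl mulrC -scalerA.
    by rewrite fD !fZ scaleII -scaleN1r -(rmorph1 (real_complex R)) -rmorphN fZ; lra.
  rewrite scalerDr !fD fa fia; apply/eqP; rewrite eq_complex /=.
  by apply/andP; split; apply/eqP; lra.
- move=> x; have hp : star (star x * x) = star x * x by rewrite (starM hA) (starK hA).
  rewrite lecE /= fI // oppr0 eqxx /=; apply: fK; apply/dbl => //.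
  exact: (spos_star_mul hA).
- by rewrite f1 fI ?(star1 hA) // oppr0.
- rewrite eq_complex /= negb_and; apply/orP; left; apply/eqP; lra.
Qed.

(** If all states kill a hermitian [h], then [t - h] and [t + h] are positive for every [t > 0], so
    [nrm h <= t] by [spos_bound]. A general [x] is treated through its hermitian parts. *)
Lemma states_separate x : (forall phi, is_state star phi -> phi x = 0) -> x = 0.
Proof.
have herm h : star h = h -> (forall phi, is_state star phi -> phi h = 0) -> h = 0.
  move=> hh h0.
  have pos k : star k = k -> (forall phi, is_state star phi -> phi k = 0) ->
      forall t, 0 < t -> spos star nrm (t%:C%:A - k).
    move=> hk k0 t t0; apply: contrapT => /(state_of_not_spos hk t0) [phi hphi].
    by rewrite k0 // eqxx.
  apply: (@nrm_small_eq0 _ _ _ _ hA _ 1) => e e0; rewrite mul1r.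
  apply: (spos_bound hA) => //; [exact: ltW|exact: pos|].
  rewrite -[h]opprK; apply: pos => //; first by rewrite (starN hA) hh.
  by move=> phi hphi; rewrite (stateN hphi) h0 // oppr0.
move=> x0.
have h1 : star (x + star x) = x + star x by rewrite (starD hA) (starK hA) addrC.
have h2 : star (I *: (x - star x)) = I *: (x - star x).
  by rewrite (starZi hA) (star_sub hA) (starK hA) -scalerN opprB.
have xs0 phi : is_state star phi -> phi (star x) = 0.
  by move=> hphi; rewrite (state_star hphi) x0 // rmorph0.
have e1 : x + star x = 0.
  by apply: herm => // phi hphi; rewrite (stateD hphi) x0 // xs0 // addr0.
have e2 : I *: (x - star x) = 0.
  by apply: herm => // phi hphi; rewrite (stateZ hphi) (stateB hphi) x0 // xs0 // subrr mulr0.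
have e3 : x - star x = 0.
  by have := scaleII (x - star x); rewrite e2 scaler0 => /esym/eqP; rewrite oppr_eq0 => /eqP.
have : (2 : R)%:C *: x = 0.
  rewrite rmorph_nat scaler_nat; have -> : x *+ 2 = (x + star x) + (x - star x) by nc_ring.
  by rewrite e1 e3 addr0.
by move=> /eqP; rewrite scaler_eq0 => /orP[|/eqP //]; rewrite eq_complex /= pnatr_eq0.
Qed.

End States.

(** * States pulled back along a linear map *)

Section Pullback.
Variables (R : realType) (A B : algType R[i]).
Variables (starA : A -> A) (nrmA : A -> R) (starB : B -> B) (nrmB : B -> R).
Hypotheses (hA : is_cstar_alg starA nrmA) (hB : is_cstar_alg starB nrmB).

(* A value [z] with [|z - c/2 + i t|^2 <= c^2/4 + t^2] for every real [t] lies in [0, c]. *)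
Lemma state_comp (T : A -> B) (phi : B -> R[i]) :
  (forall (a : R[i]) x y, T (a *: x + y) = a *: T x + T y) -> T 1 = 1 ->
  (forall x, numrad starB (T x) <= numrad starA x) ->
  is_state starB phi -> is_state starA (fun x => phi (T x)).
Proof.
move=> hlin hunit hnu hphi; split; last by rewrite hunit (state1 hphi).
  by move=> a x y; rewrite hlin (stateD hphi) (stateZ hphi).
move=> x; set p := starA x * x; set c := nrmA p.
have hp : starA p = p by rewrite (starM hA) (starK hA).
(* States of [A] map [p] into the interval from [0] to [c], all of whose points are within
   [sqrt (c^2 / 4 + t^2)] of [c / 2 - i t]. The numerical radius carries this bound over to
   [phi (T p)]. *)
have bound t : cabs (phi (T p) + ((- (c / 2)) +i* t)%C) ^+ 2 <= (c / 2) ^+ 2 + t ^+ 2.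
  have -> : phi (T p) + ((- (c / 2)) +i* t)%C = phi (T (((- (c / 2)) +i* t)%C *: 1 + p)).
    by rewrite hlin hunit (stateD hphi) (stateZ hphi) (state1 hphi) mulr1 addrC.
  set m := (c / 2) ^+ 2 + t ^+ 2; have m0 : 0 <= m by rewrite addr_ge0 // sqr_ge0.
  rewrite -(sqr_sqrtr m0) ler_sqr ?nnegrE ?sqrtr_ge0 ?cabs_ge0 //.
  apply: le_trans (state_le_numrad hB _ hphi) _; apply: le_trans (hnu _) _.
  apply: numrad_le; first exact: sqrtr_ge0.
  move=> psi hpsi; rewrite -ler_sqr ?nnegrE ?sqrtr_ge0 ?cabs_ge0 // sqr_sqrtr // cabs_sqr.
  rewrite (stateD hpsi) (stateZ hpsi) (state1 hpsi) mulr1.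
  have i0 := state_herm_im hA hpsi hp; have r1 := state_herm_le hA hpsi hp.
  have : 0 <= psi p by case: hpsi => _ + _; apply.
  rewrite lecE /= i0 eqxx /= -/c => r0; rewrite -/c in r1.
  move: i0 r0 r1; case: (psi p) => a b /= -> a0 ac.
  have : 0 <= a * (c - a) by rewrite mulr_ge0 // subr_ge0.
  by rewrite /m addr0; nra.
case E : (phi (T p)) bound => [a b] bound.
have {}bound t : (a - c / 2) ^+ 2 + (b + t) ^+ 2 <= (c / 2) ^+ 2 + t ^+ 2.
  by have := bound t; rewrite cabs_sqr.
have b0 : b = 0.
  apply/eqP; apply/negPn/negP => bn0.
  (* Chosen so that the cross term [2 b t] exceeds [c^2 / 4]. *)
  set t := ((c / 2) ^+ 2 + 1) / (2 * b); have := bound t.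
  have bt : 2 * b * t = (c / 2) ^+ 2 + 1 by rewrite /t; field.
  have := sqr_ge0 (a - c / 2); have := sqr_ge0 b.
  have -> : (b + t) ^+ 2 = b ^+ 2 + 2 * b * t + t ^+ 2 by ring.
  rewrite bt; lra.
rewrite lecE /= b0 eqxx /=; have := bound 0; rewrite b0 addr0 expr0n /= !addr0.
have c0 : 0 <= c := nrm_ge0 hA p.
move=> h; rewrite leNgt; apply/negP => a0.
have : 0 < (c / 2 - a) ^+ 2 - (c / 2) ^+ 2.
  have -> : (c / 2 - a) ^+ 2 - (c / 2) ^+ 2 = - a * (c - a) by field.
  by rewrite mulr_gt0 //; lra.
by rewrite -(sqrrN (c / 2 - a)) opprB; lra.
Qed.

End Pullback.

(** * Kadison's inequality *)

(** The functional [phi (star y * x * y) + e phi x] of [x], once normalized, is a state, so it is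
    nonnegative at [p]; then [e] tends to [0]. The term in [e] keeps the normalization possible when
    [phi (star y * y) = 0]. *)
Lemma state_compress_ge0 (R : realType) (B : algType R[i]) (star : B -> B)
    (nrm : B -> R) (hB : is_cstar_alg star nrm) (phi : B -> R[i]) (y p : B) :
  is_state star phi -> (forall rho, is_state star rho -> 0 <= rho p) ->
  0 <= phi (star y * p * y).
Proof.
move=> hphi p0.
have pos x : 0 <= phi (star x * x) by case: hphi => _ + _; apply.
set d := complex.Re (phi (star y * y)).
have d0 : 0 <= d by move: (pos y); rewrite lecE => /andP[_].
have dE : phi (star y * y) = d%:C.
  by rewrite /d; have := ger0_Im (pos y); case: (phi _) => a b /= ->.
have step (e : R) : 0 < e -> 0 <= phi (star y * p * y) + e%:C * phi p.
  move=> e0; have de : 0 < d + e by lra.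
  pose rho x := (d + e)^-1%:C * (phi (star y * x * y) + e%:C * phi x).
  suff hrho : is_state star rho.
    by have := p0 _ hrho; rewrite pmulr_rge0 // ltcR invr_gt0.
  split.
  - move=> a x z; rewrite /rho.
    have -> : star y * (a *: x + z) * y = a *: (star y * x * y) + star y * z * y.
      by rewrite mulrDr mulrDl -scalerAr -scalerAl.
    by rewrite !(stateD hphi) !(stateZ hphi); ring.
  - move=> x; rewrite mulr_ge0 ?lecR ?invr_ge0 ?(ltW de) //.
    rewrite addr_ge0 ?mulr_ge0 ?lecR ?(ltW e0) //.
    by have := pos (x * y); rewrite (starM hB) !mulrA.
  - by rewrite /rho mulr1 dE (state1 hphi) mulr1 -rmorphD -rmorphM mulVf ?gt_eqF // rmorph1.
have := p0 _ hphi; move: step; case: (phi (_ * _)) => a b; case: (phi p) => u v step.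
rewrite !lecE /= => /andP[/eqP v0 u0].
have b0 : b = 0 by have := step 1 ltr01; rewrite lecE /= => /andP[/eqP + _]; lra.
rewrite b0 eqxx /= leNgt; apply/negP => a0.
(* With this value [a + e u = a / 2 - e], which is negative. *)
have e0 : 0 < - a / (2 * (u + 1)) by rewrite divr_gt0 //; lra.
have := step _ e0; rewrite lecE /= => /andP[_]; set e := _ / _.
have : e * u + e = - a / 2 by rewrite /e; field; apply/eqP; lra.
by rewrite -/e in e0; lra.
Qed.

Section KadisonInequality.
Variables (R : realType) (A B : algType R[i]).
Variables (starA : A -> A) (nrmA : A -> R) (starB : B -> B) (nrmB : B -> R).
Hypotheses (hA : is_cstar_alg starA nrmA) (hB : is_cstar_alg starB nrmB).
Variable T : A -> B.
Hypotheses (hlin : forall (a : R[i]) x y, T (a *: x + y) = a *: T x + T y)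
  (hunit : T 1 = 1)
  (hst : forall phi, is_state starB phi -> is_state starA (fun x => phi (T x))).

Lemma linD x y : T (x + y) = T x + T y.
Proof. by have := hlin 1 x y; rewrite !scale1r. Qed.

Lemma lin0 : T 0 = 0.
Proof. by apply: (@addrI _ (T 0)); rewrite -linD !addr0. Qed.

Lemma linZ (c : R[i]) x : T (c *: x) = c *: T x.
Proof. by have := hlin c x 0; rewrite lin0 !addr0. Qed.

Lemma linN x : T (- x) = - T x.
Proof. by rewrite -[- x]scaleN1r linZ scaleN1r. Qed.

Lemma linB x y : T (x - y) = T x - T y.
Proof. by rewrite linD linN. Qed.

Lemma linMn x n : T (x *+ n) = T x *+ n.
Proof. by elim: n => [|n IH]; rewrite ?mulr0n ?lin0 // !mulrS linD IH. Qed.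

Lemma lin_star x : T (starA x) = starB (T x).
Proof.
apply/eqP; rewrite -subr_eq0; apply/eqP/(states_separate hB) => phi hphi.
by rewrite (stateB hphi) (state_star hB hphi) (state_star hA (hst hphi)) subrr.
Qed.

Section Bernstein.
Variables (h w1 w2 : A) (phi : B -> R[i]) (X : B).
Hypotheses (hw1 : starA w1 = w1) (hw2 : starA w2 = w2) (w12 : w1 * w2 = w2 * w1).
Hypotheses (w1h : w1 * w1 = h) (w2h : w2 * w2 = 1 - h).
Hypotheses (hphi : is_state starB phi) (hX : starB X = X).

(* With [p_k = 'C(n, k) h^k (1 - h)^(n - k)] this is the closed form of
   [\sum_k (mu + k - X) * T (q * p_k) * (mu + k - X)]; the recursion in [n] below is
   Pascal's rule. *)
Definition bernstein_form n (q : A) (mu : R) : B :=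
  let m := mu%:C%:A + h *+ n in
  T (q * (m * m + h *+ n - h *+ n * h)) - X * T (q * m) - T (q * m) * X + X * T q * X.

Lemma bernstein_form0 q mu :
  bernstein_form 0 q mu = (mu%:C%:A - X) * T q * (mu%:C%:A - X).
Proof.
rewrite /bernstein_form mulr0n mul0r !addr0 subr0.
rewrite -!(scalerAl, scalerAr) !mulr1 !linZ mulrBl mulrBr -!(scalerAl, scalerAr) mul1r.
by rewrite mulr1 scalerBr mulrBl -scalerAl; nc_ring.
Qed.

Lemma bernstein_formS n q mu : bernstein_form n.+1 q mu =
  bernstein_form n (q * (1 - h)) mu + bernstein_form n (q * h) (mu + 1).
Proof.
rewrite /bernstein_form mulrSr constD const1.
set H := h *+ n; rewrite [mu%:C%:A + (H + h)]addrA; set m := mu%:C%:A + H.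
have mh : m * h = h * m.
  by rewrite /m /H mulrDl mulrDr -scalerAl -scalerAr mul1r mulr1 mulrnAl mulrnAr.
rewrite [mu%:C%:A + 1 + _]addrAC -/m.
have -> : (m + h) * (m + h) + (H + h) - (H + h) * h =
    (1 - h) * (m * m + H - H * h) + h * ((m + 1) * (m + 1) + H - H * h).
  (* The two sides differ by a commutator, which vanishes because [m] is a polynomial in [h]. *)
  transitivity ((1 - h) * (m * m + H - H * h) + h * ((m + 1) * (m + 1) + H - H * h)
    + (m * h - h * m)); first by nc_ring.
  by rewrite mh subrr addr0.
have -> : m + h = (1 - h) * m + h * (m + 1) by nc_ring.
have qD u v : T (q * ((1 - h) * u + h * v)) = T (q * (1 - h) * u) + T (q * h * v).
  by rewrite mulrDr linD !mulrA.
have -> : T q = T (q * (1 - h)) + T (q * h) by rewrite -linD -mulrDr subrK mulr1.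
by rewrite !qD; nc_ring.
Qed.

(** The weights remain hermitian squares along the recursion: [z^2 (1 - h) = (z w2)^2] and
    [z^2 h = (z w1)^2]. At [n = 0] the form is a compression of [T (z^2)], on which all states are
    nonnegative. *)
Lemma bernstein_form_ge0 n z mu : starA z = z -> z * w1 = w1 * z -> z * w2 = w2 * z ->
  0 <= phi (bernstein_form n (z * z) mu).
Proof.
elim: n z mu => [|n IH] z mu hz c1 c2.
  rewrite bernstein_form0.
  have hy : starB (mu%:C%:A - X) = mu%:C%:A - X by rewrite (star_sub hB) (star_const hB) hX.
  rewrite -{1}hy; apply: (state_compress_ge0 hB) => // rho hrho.
  by have := state_sqr_ge0 (hst hrho) hz.
rewrite bernstein_formS (stateD hphi) addr_ge0 //.
  have -> : z * z * (1 - h) = (z * w2) * (z * w2) 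
    by rewrite -w2h [RHS]mulrA -[z * w2 * z]mulrA -c2 !mulrA.
  apply: IH.
  - by rewrite (starM hA) hz hw2.
  - by rewrite -mulrA -w12 !mulrA c1.
  - by rewrite -mulrA [RHS]mulrA -c2 mulrA.
have -> : z * z * h = (z * w1) * (z * w1) 
    by rewrite -w1h [RHS]mulrA -[z * w1 * z]mulrA -c1 !mulrA.
apply: IH.
- by rewrite (starM hA) hz hw1.
- by rewrite [RHS]mulrA -c1.
- by rewrite -mulrA w12 !mulrA c2.
Qed.

End Bernstein.

Lemma kadison_ineq h w1 w2 phi : starA w1 = w1 -> starA w2 = w2 -> w1 * w2 = w2 * w1 ->
  w1 * w1 = h -> w2 * w2 = 1 - h -> is_state starB phi ->
  complex.Re (phi (T h * T h)) <= complex.Re (phi (T (h * h))).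
Proof.
move=> hw1 hw2 w12 w1h w2h hphi.
have hh : starA h = h by rewrite -w1h (starM hA) hw1.
set a := complex.Re (phi (T h * T h)); set b := complex.Re (phi (T (h * h))).
set c := complex.Re (phi (T (h - h * h))).
have key n : 0 <= n%:R * (n%:R * (b - a) + c).
  have hX : starB (T h *+ n) = T h *+ n by rewrite -linMn -lin_star -scaler_nat (starZ hA) conjC_nat hh.
  have comm1 w : 1 * w = w * 1 :> A by rewrite mulr1 mul1r.
  (* With [z = 1], [mu = 0] and [X = n T h] the form becomes
     [n^2 (T (h^2) - (T h)^2) + n T (h - h^2)]. *)
  have := bernstein_form_ge0 hw1 hw2 w12 w1h w2h hphi hX n 0 (star1 hA) (comm1 _) (comm1 _).
  rewrite /bernstein_form rmorph0 scale0r add0r !mul1r hunit mulr1 linMn.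
  have -> : h *+ n * (h *+ n) + h *+ n - h *+ n * h = (h * h) *+ n *+ n + (h - h * h) *+ n.
    by rewrite mulrnAl mulrnAr !mulrnAl mulrnBl addrA.
  have XX : T h *+ n * (T h *+ n) = (T h * T h) *+ n *+ n by rewrite mulrnAl mulrnAr.
  rewrite linD !linMn -addrA addNr addr0 XX.
  have phiMn (k : nat) x : phi (x *+ k) = k%:R%:C * phi x.
    by rewrite -scaler_nat (stateZ hphi) rmorph_nat.
  rewrite (stateB hphi) (stateD hphi) !phiMn.
  rewrite /a /b /c lecE => /andP[_].
  case: (phi (T h * T h)) => a1 a2; case: (phi (T (h * h))) => b1 b2.
  by case: (phi (T (h - h * h))) => c1 c2 /=; rewrite !mul0r !subr0 => /le_trans; apply; lra.
rewrite leNgt; apply/negP => ba.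
have d0 : 0 < a - b by lra.
have [n hn] := exists_nat_gt (`|c| / (a - b)).
have n0 : 0 < n%:R :> R by apply: le_lt_trans hn; rewrite divr_ge0 // ltW.
have := key n; rewrite pmulr_rge0 //; move: hn; rewrite ltr_pdivrMr //.
have := ler_norm c; lra.
Qed.

End KadisonInequality.

(** Supplies the commuting roots required by [kadison_ineq]: [h] and [1 - h] are the halves of
    [1 + g] and [1 - g], and [herm_sqrt] applies to [- g] and to [g]. *)
Lemma herm_half_sqrt (R : realType) (A : algType R[i]) (star : A -> A) (nrm : A -> R)
    (hA : is_cstar_alg star nrm) (g : A) : star g = g -> nrm g < 1 ->
  let h := (2^-1 : R)%:C *: (1 + g) in exists w1 w2,
  [/\ star w1 = w1, star w2 = w2, w1 * w2 = w2 * w1, w1 * w1 = h & w2 * w2 = 1 - h].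
Proof.
move=> hg g1 h.
have hNg : star (- g) = - g by rewrite (starN hA) hg.
have Ng1 : nrm (- g) < 1 by rewrite (nrmN hA).
have [w1 [hw1 ww1 wc1]] := herm_sqrt hA hNg Ng1.
have [w2 [hw2 ww2 wc2]] := herm_sqrt hA hg g1.
have w12 : w1 * w2 = w2 * w1.
  by apply: wc2; apply/esym/wc1; rewrite mulrN mulNr.
have half0 : (0 : R) <= 2^-1 by rewrite invr_ge0.
exists ((Num.sqrt (2^-1 : R))%:C *: w1), ((Num.sqrt (2^-1 : R))%:C *: w2); split.
- by rewrite (starZr hA) hw1.
- by rewrite (starZr hA) hw2.
- by rewrite -!(scalerAl, scalerAr) w12.
- by rewrite -scalerAl -scalerAr scalerA -rmorphM -expr2 sqr_sqrtr // ww1 opprK.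
- rewrite -scalerAl -scalerAr scalerA -rmorphM -expr2 sqr_sqrtr // ww2 /h.
  have e1 : (2^-1 : R)%:C *: (1 + 1) = 1 :> A.
    by rewrite scalerDr -scalerDl -rmorphD (_ : 2^-1 + 2^-1 = 1 :> R) ?rmorph1 ?scale1r //; lra.
  rewrite -[X in _ = X - _]e1 -scalerBr.
  by have -> : 1 + 1 - (1 + g) = 1 - g by nc_ring.
Qed.

(** * Jordan isomorphisms *)

Section JordanIsomorphism.
Variables (R : realType) (A B : algType R[i]).
Variables (starA : A -> A) (nrmA : A -> R) (starB : B -> B) (nrmB : B -> R).
Hypotheses (hA : is_cstar_alg starA nrmA) (hB : is_cstar_alg starB nrmB).
Variables (T : A -> B) (S : B -> A).
Hypotheses (hlin : forall (a : R[i]) x y, T (a *: x + y) = a *: T x + T y)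
  (hunit : T 1 = 1)
  (hst : forall phi, is_state starB phi -> is_state starA (fun x => phi (T x))).
Hypotheses (TK : cancel T S) (SK : cancel S T)
  (hstS : forall psi, is_state starA psi -> is_state starB (fun y => psi (S y))).
Local Notation I := ('i%C : R[i]).

Let slin (a : R[i]) x y : S (a *: x + y) = a *: S x + S y.
Proof. by apply: (can_inj TK); rewrite hlin !SK. Qed.

Let sunit : S 1 = 1.
Proof. by rewrite -hunit TK. Qed.

(* Kadison's inequality for [T] and for [S] at [h = (1 + g) / 2]. *)
Lemma jordan_sqr_small g : starA g = g -> nrmA g < 1 -> nrmB (T g) < 1 ->
  T (g * g) = T g * T g.
Proof.
move=> hg g1 Tg1; have hTg : starB (T g) = T g by rewrite -(lin_star hA hB hst) hg.
set h := (2^-1 : R)%:C *: (1 + g).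
have Th : T h = (2^-1 : R)%:C *: (1 + T g) by rewrite (linZ hlin) (linD hlin) hunit.
have [u1 [u2 [hu1 hu2 u12 u1h u2h]]] := herm_half_sqrt hA hg g1.
have [v1 [v2 [hv1 hv2 v12 v1h v2h]]] := herm_half_sqrt hB hTg Tg1.
rewrite -/h in u1h u2h; rewrite -Th in v1h v2h.
have hh : starA h = h by rewrite -u1h (starM hA) hu1.
have hTh : starB (T h) = T h by rewrite -v1h (starM hB) hv1.
have e : T (h * h) = T h * T h.
  apply/eqP; rewrite -subr_eq0; apply/eqP/(states_separate hB) => phi hphi.
  have le1 := kadison_ineq hA hB hlin hunit hst hu1 hu2 u12 u1h u2h hphi.
  (* The inequality for [S] at [T h], tested on the state [phi \o T], is the reverse of [le1]. *)
  have le2 := kadison_ineq hB hA slin sunit hstS hv1 hv2 v12 v1h v2h (hst hphi).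
  rewrite TK SK in le2.
  have i1 : complex.Im (phi (T (h * h))) = 0.
    by apply: (state_herm_im hB hphi); rewrite -(lin_star hA hB hst) (starM hA) hh.
  have i2 : complex.Im (phi (T h * T h)) = 0.
    by apply: (state_herm_im hB hphi); rewrite (starM hB) hTh.
  rewrite (stateB hphi); move: le1 le2 i1 i2.
  case: (phi (T h * T h)) => a b; case: (phi (T (h * h))) => c d /= ca ac -> ->.
  by apply/eqP; rewrite eq_complex /=; apply/andP; split; apply/eqP; lra.
have hE : h + h = 1 + g.
  by rewrite -scalerDl -rmorphD (_ : 2^-1 + 2^-1 = 1 :> R) ?rmorph1 ?scale1r //; lra.
(* Back from [h] to [g = 2 h - 1]. *)
have -> : g * g = (h * h) *+ 4 - h *+ 4 + 1.
  have -> : g = h + h - 1 by rewrite hE; nc_ring.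
  by rewrite -[4%N]/(2 * 2)%N !mulrnA; nc_ring.
have -> : T g = T h + T h - 1.
  by rewrite -(linD hlin) hE (linD hlin) hunit; nc_ring.
rewrite (linD hlin) (linB hlin) !(linMn hlin) e hunit.
by rewrite -[4%N]/(2 * 2)%N !mulrnA; nc_ring.
Qed.

Lemma jordan_sqrZ (c : R[i]) x : T (x * x) = T x * T x ->
  T ((c *: x) * (c *: x)) = T (c *: x) * T (c *: x).
Proof. by move=> e; rewrite !(linZ hlin) -!scalerAl -!scalerAr !(linZ hlin) e. Qed.

Lemma jordan_sqr_herm g : starA g = g -> T (g * g) = T g * T g.
Proof.
(* Dividing by [r] brings both [g] and [T g] to norm less than one. *)
move=> hg; set r := nrmA g + nrmB (T g) + 1.
have nA := nrm_ge0 hA g; have nB := nrm_ge0 hB (T g).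
have r0 : 0 < r by rewrite /r; lra.
have -> : g = r%:C *: (r^-1%:C *: g).
  by rewrite scalerA -rmorphM mulfV ?gt_eqF // rmorph1 scale1r.
apply: jordan_sqrZ; apply: jordan_sqr_small.
- by rewrite (starZr hA) hg.
- by rewrite (nrmZr hA) ger0_norm ?invr_ge0 1?ltW // mulrC ltr_pdivrMr // /r; lra.
- rewrite (linZ hlin) (nrmZr hB) ger0_norm ?invr_ge0 1?ltW // mulrC ltr_pdivrMr //.
  by rewrite /r; lra.
Qed.

(** Write [x = (p - i q) / 2] with [p] and [q] hermitian. The hermitian case at [p], [q] and [p + q]
    gives the squares and the cross term [p q + q p]. *)
Lemma jordan_sqr x : T (x * x) = T x * T x.
Proof.
set p := x + starA x; set q := I *: (x - starA x).
have hp : starA p = p by rewrite (starD hA) (starK hA) addrC.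
have hq : starA q = q.
  by rewrite (starZi hA) (star_sub hA) (starK hA) -scalerN opprB.
have hpq : starA (p + q) = p + q by rewrite (starD hA) hp hq.
have -> : x = (2^-1 : R)%:C *: (p - I *: q).
  rewrite /q scaleII opprK /p addrACA subrr addr0 scalerDr -scalerDl -rmorphD.
  by rewrite (_ : 2^-1 + 2^-1 = 1 :> R) ?rmorph1 ?scale1r //; lra.
apply: jordan_sqrZ.
have ep := jordan_sqr_herm hp; have eq := jordan_sqr_herm hq.
have epq : T (p * q + q * p) = T p * T q + T q * T p.
  have -> : p * q + q * p = (p + q) * (p + q) - p * p - q * q by nc_ring.
  by rewrite !(linB hlin) ep eq (jordan_sqr_herm hpq) !(linD hlin); nc_ring.
have sq (D : algType R[i]) (a b : D) :
    (a - I *: b) * (a - I *: b) = a * a - b * b - I *: (a * b + b * a).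
  rewrite mulrBl !mulrBr -!scalerAl -!scalerAr scaleII scalerDr; nc_ring.
by rewrite (linB hlin) (linZ hlin) !sq !(linB hlin) (linZ hlin) ep eq epq.
Qed.

Lemma jordan_jprod x y : T (jprod x y) = jprod (T x) (T y).
Proof.
have e : T (x * y + y * x) = T x * T y + T y * T x.
  have -> : x * y + y * x = (x + y) * (x + y) - x * x - y * y by nc_ring.
  by rewrite !(linB hlin) !jordan_sqr !(linD hlin); nc_ring.
by rewrite /jprod (linZ hlin) e.
Qed.

End JordanIsomorphism.

(** * Injectivity, the inverse map and the conclusion *)

Unset Implicit Arguments.
Set Strict Implicit.

Theorem theorem5p1 (R : realType) (A B : algType R[i])
    (starA : A -> A) (nrmA : A -> R) (starB : B -> B) (nrmB : B -> R)
    (hA : is_cstar_alg starA nrmA) (hB : is_cstar_alg starB nrmB)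
    (T : A -> B)
    (hlin : forall (a : R[i]) x y, T (a *: x + y) = a *: T x + T y)
    (hunit : T 1 = 1)
    (hsurj : forall y : B, exists x : A, T x = y)
    (hnu : forall x : A, numrad starB (T x) = numrad starA x) :
  jordan_star_iso starA starB T.
Proof.
have hst phi : is_state starB phi -> is_state starA (fun x => phi (T x)).
  by apply: (state_comp hA hB) => // x; rewrite hnu.
(* If [T x = 0], then [x] has numerical radius zero, so every state vanishes at [x]. *)
have Tinj x : T x = 0 -> x = 0.
  move=> Tx0; apply: (states_separate hA) => psi hpsi.
  have := state_le_numrad hA x hpsi; rewrite -hnu Tx0 (numrad0 hB) => h.
  have : cabs (psi x) ^+ 2 = 0.
    by rewrite (_ : cabs _ = 0) ?expr0n //; apply/eqP; rewrite eq_le h cabs_ge0.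
  rewrite cabs_sqr => /eqP; rewrite paddr_eq0 ?sqr_ge0 // !sqrf_eq0.
  by case: (psi x) => a b /= e; apply/eqP; rewrite eq_complex.
(* Choice gives a right inverse, which injectivity makes two-sided. *)
have [S SK] := choice hsurj.
have TK : cancel T S.
  move=> x; apply/eqP; rewrite -subr_eq0; apply/eqP/Tinj.
  by rewrite (linB hlin) SK subrr.
have slin (a : R[i]) x y : S (a *: x + y) = a *: S x + S y.
  by apply: (can_inj TK); rewrite hlin !SK.
have hstS psi : is_state starA psi -> is_state starB (fun y => psi (S y)).
  apply: (state_comp hB hA) => //; first by rewrite -hunit TK.
  by move=> y; rewrite -hnu SK.
split=> //.
- by exists S.
- exact: (lin_star hA hB hst).
- exact: (jordan_jprod hA hB hlin hunit hst TK SK hstS).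
Qed.
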